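(* Let $s_{\max}>0$ and $a>0$ with $\frac d2<a<s_{\max}$; assume the wavelet assumption (W) and the operator assumption (B) below, let $D:=\mathcal{S}^{-1}(D_F)$, and assume that whenever $x\in D$ and $z\in b^{-a}_{2,2}$ with $|z_\lambda|\le|x_\lambda|$ for all $\lambda$, then $z\in D$. Let $f^+\in D_F\cap B^0_{1,1}(\Omega)$, $s>0$, $t_s=\frac{2a}{s+2a}$, and for each $\alpha>0$ let $f_\alpha=\mathcal{S}x_\alpha$ with $x_\alpha\in\operatorname{argmin}_{x\in D}\left[\frac12\|F(f^+)-F(\mathcal{S}x)\|_{\mathbb{Y}}^2+\alpha\|x\|_{b^0_{1,1}}\right]$. The following are equivalent: (i) $f^+\in K_{t_s}$; (ii) there is $C_2>0$ with $\|f^+-f_\alpha\|_{B^0_{1,1}}\le C_2\alpha^{\frac{s}{s+2a}}$ for all $\alpha>0$; (iii) there is $C_3>0$ with $\|F(f^+)-F(f_\alpha)\|_{\mathbb{Y}}\le C_3\alpha^{\frac{s+a}{s+2a}}$ for all $\alpha>0$. More precisely, there is a constant $c>0$ depending only on $L$, $t_s$ and the operator norms of $\mathcal{S}$ and $\mathcal{S}^{-1}$ such that one can choose $C_2=c\|f^+\|_{K_{t_s}}^{t_s}$, $C_3=cC_2^{1/2}$, and (iii) implies $\|f^+\|_{K_{t_s}}\le cC_3^{2/t_s}$.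
   Context: $\Omega$ is either a bounded Lipschitz domain in $\mathbb{R}^d$ or the torus $(\mathbb{R}/\mathbb{Z})^d$; $B^s_{p,q}(\Omega)$ denote the standard Besov spaces with norms $\|\cdot\|_{B^s_{p,q}}$. $(\Lambda_j)_{j\in\mathbb{N}_0}$ are finite sets with $2^{jd}\le|\Lambda_j|\le C_\Lambda2^{jd}$, $\Lambda=\{(j,k):j\in\mathbb{N}_0,k\in\Lambda_j\}$. For $p,q\in(0,\infty]$, $s\in\mathbb{R}$, $b^s_{p,q}=\{x\in\mathbb{R}^\Lambda:\|x\|_{b^s_{p,q}}<\infty\}$ with $\|x\|_{b^s_{p,q}}^q=\sum_{j}2^{jq(s+\frac d2-\frac dp)}\left(\sum_{k\in\Lambda_j}|x_{j,k}|^p\right)^{q/p}$ (usual modifications for $p$ or $q=\infty$). (W): $(\phi_{j,k})$ are real functions on $\Omega$ such that the synthesis operator $\mathcal{S}x=\sum_{(j,k)}x_{j,k}\phi_{j,k}$ is a norm isomorphism $b^s_{p,q}\to B^s_{p,q}(\Omega)$ for all $s\in(-s_{\max},s_{\max})$, $p,q\in(0,\infty]$. (B): $D_F\subseteq B^{-a}_{2,2}(\Omega)$ is non-empty and closed, $\mathbb{Y}$ is a Banach space, $F:D_F\to\mathbb{Y}$, and there is $L>0$ with $L^{-1}\|f_1-f_2\|_{B^{-a}_{2,2}}\le\|F(f_1)-F(f_2)\|_{\mathbb{Y}}\le L\|f_1-f_2\|_{B^{-a}_{2,2}}$ for all $f_1,f_2\in D_F$. Weights: $\overline{a}_{(j,k)}=2^{-ja}$,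 $\overline{r}_{(j,k)}=2^{-jd/2}$. For $t\in(0,2)$, $k_t=\{x:\|x\|_{k_t}<\infty\}$ with $\|x\|_{k_t}=\sup_{\alpha>0}\alpha\left(\sum_{\lambda\in\Lambda}\overline{a}_\lambda^{-2}\overline{r}_\lambda^2\mathbf{1}_{\{\overline{a}_\lambda^{-2}\overline{r}_\lambda\alpha<|x_\lambda|\}}\right)^{1/t}$; $K_t=\mathcal{S}(k_t)$ with $\|f\|_{K_t}=\|\mathcal{S}^{-1}f\|_{k_t}$. *)

(* Defs.v *)
From HB Require Import structures.
From mathcomp Require Import all_boot all_order all_algebra.
From mathcomp Require Import all_classical all_reals all_analysis.
Set Implicit Arguments. Unset Strict Implicit. Unset Printing Implicit Defensive.
Import Order.TTheory GRing.Theory Num.Theory.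
Import numFieldNormedType.Exports.
Local Open Scope classical_set_scope.
Local Open Scope ring_scope.

Definition Idx (N : nat -> nat) : Type := {j : nat & 'I_(N j)}.

Definition idx (N : nat -> nat) (j : nat) (k : 'I_(N j)) : Idx N :=
  existT (fun j => 'I_(N j)) j k.

Section SeqNorms.
Variable R : realType.

Definition lp_level (N : nat -> nat) (p : \bar R) (x : Idx N -> R) (j : nat) : R :=
  match p with
  | r%:E => (\sum_(k < N j) `|x (idx k)| `^ r) `^ r^-1
  | +oo%E => \big[Num.max/0]_(k < N j) `|x (idx k)|
  | -oo%E => 0
  end.

Definition d_over (d : nat) (p : \bar R) : R :=
  match p with r%:E => d%:R / r | _ => 0 end.

(* the (quasi-)norm of b^s_{p,q}, valued in [0, +oo]; x in b^s_{p,q} iff < +oo *)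
Definition bnorm (d : nat) (N : nat -> nat) (s : R) (p q : \bar R)
  (x : Idx N -> R) : \bar R :=
  let w j := 2 `^ (j%:R * (s + d%:R / 2 - d_over d p)) * lp_level p x j in
  match q with
  | r%:E => poweR (\sum_(0 <= j <oo) ((w j) `^ r)%:E)%E r^-1
  | +oo%E => ereal_sup (range (fun j => (w j)%:E))
  | -oo%E => 0%E
  end.

(* sum_lambda abar^-2 rbar^2 1{abar^-2 rbar alpha < |x_lambda|},
   abar_(j,k) = 2^(-ja), rbar_(j,k) = 2^(-jd/2) *)
Definition kt_sum (d : nat) (N : nat -> nat) (a : R) (x : Idx N -> R) (al : R)
  : \bar R :=
  (\sum_(0 <= j <oo)
     (\sum_(k < N j)
        (if 2 `^ (j%:R * (2 * a - d%:R / 2)) * al < `|x (idx k)|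
         then 2 `^ (j%:R * (2 * a - d%:R)) else 0))%:E)%E.

Definition kt_norm (d : nat) (N : nat -> nat) (a t : R) (x : Idx N -> R) : \bar R :=
  ereal_sup [set (al%:E * poweR (kt_sum d a x al) t^-1)%E | al in [set al : R | 0 < al]].

End SeqNorms.

Section Assumptions.
Variable R : realType.
Local Open Scope ereal_scope.

(* Abstract model of the function/distribution side: X is a real vector space
   containing Omega's distributions, Bn s p q f = ||f||_{B^s_{p,q}(Omega)} in
   [0,+oo] (f in B^s_{p,q}(Omega) iff Bn s p q f < +oo). *)

Definition assumption_W (d : nat) (N : nat -> nat) (smax : R) (X : lmodType R)
  (Bn : R -> \bar R -> \bar R -> X -> \bar R) (S : (Idx N -> R) -> X) : Prop :=
  (forall (c : R) (x y : Idx N -> R),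
      S (fun l => c * x l + y l)%R = (c *: S x + S y)%R) /\
  forall (s : R) (p q : \bar R), (- smax < s < smax)%R -> 0 < p -> 0 < q ->
    [/\ forall x, bnorm d s p q x < +oo -> Bn s p q (S x) < +oo,
        forall f, Bn s p q f < +oo -> exists x, bnorm d s p q x < +oo /\ S x = f
      & exists C : R, (0 < C)%R /\
          forall x, bnorm d s p q x < +oo ->
            Bn s p q (S x) <= C%:E * bnorm d s p q x /\
            bnorm d s p q x <= C%:E * Bn s p q (S x)].

Definition opnorm_bound (d : nat) (N : nat -> nat) (a M : R) (X : lmodType R)
  (Bn : R -> \bar R -> \bar R -> X -> \bar R) (S : (Idx N -> R) -> X) : Prop :=
  forall (s : R) (p : \bar R), (s, p) = (0%R, 1) \/ (s, p) = ((- a)%R, 2%:E) ->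
    forall x, bnorm d s p p x < +oo ->
      Bn s p p (S x) <= M%:E * bnorm d s p p x /\
      bnorm d s p p x <= M%:E * Bn s p p (S x).

Definition assumption_B (a L : R) (X : lmodType R)
  (Bn : R -> \bar R -> \bar R -> X -> \bar R) (Y : normedModType R)
  (DF : set X) (F : X -> Y) : Prop :=
  [/\ (0 < L)%R,
      DF !=set0,
      (forall f, DF f -> Bn (- a)%R 2%:E 2%:E f < +oo),
      (forall (u : nat -> X) (f : X), (forall n, DF (u n)) ->
          Bn (- a)%R 2%:E 2%:E f < +oo ->
          (fun n => Bn (- a)%R 2%:E 2%:E (u n - f)%R) @ \oo --> 0 -> DF f)
    & forall f1 f2, DF f1 -> DF f2 ->
        (L^-1)%:E * Bn (- a)%R 2%:E 2%:E (f1 - f2)%R <= (`|F f1 - F f2|)%:E /\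
        (`|F f1 - F f2|)%:E <= L%:E * Bn (- a)%R 2%:E 2%:E (f1 - f2)%R].

Definition Dset (d : nat) (N : nat -> nat) (a : R) (X : lmodType R)
  (S : (Idx N -> R) -> X) (DF : set X) : set (Idx N -> R) :=
  [set x | bnorm d (- a)%R 2%:E 2%:E x < +oo /\ DF (S x)].

Definition Tik (d : nat) (N : nat -> nat) (X : lmodType R) (Y : normedModType R)
  (S : (Idx N -> R) -> X) (F : X -> Y) (fp : X) (al : R) (x : Idx N -> R) : \bar R :=
  (2^-1 * `|F fp - F (S x)| ^+ 2)%:E + al%:E * bnorm d 0%R 1 1 x.

End Assumptions.

(* Main.v *)
(** Let r = rbar and w = abar^-2 rbar, and let W(b) be the sum of r w over the
indices with |x| > w b, where S x = f^+; the k_t norm encodes W(b) <= Q b^-t.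

(i) => (ii): split ||x - x_alpha||_{1} at the threshold w alpha.  Above it,
Young's inequality trades the error for W(alpha) and the weighted l2 error, and
the latter is absorbed by the residual because F o S is bi-Lipschitz.  Below
it, the mass of x is summed over dyadic thresholds, which converges as t < 1.

(ii) => (iii): minimality gives residual^2 / 2 <= alpha (||x|| - ||x_alpha||).

(iii) => (i): comparing the minimizers for alpha and alpha / 2 bounds the
increments of ||x|| - ||x_alpha|| dyadically; since this defect tends to 0 by
lower semicontinuity of the l1 norm, it is O(alpha^(1-t)).  Testing minimality
with x shrunk by w b on {|x| > w b}, where b = alpha / Lip^2, shows that
b W(b) is at most twice the defect. *)

Require Import Defs.
From HB Require Import structures.
From mathcomp Require Import all_boot all_order all_algebra.
From mathcomp Require Import all_classical all_reals all_analysis.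
From mathcomp Require Import ring lra.
Set Implicit Arguments. Unset Strict Implicit. Unset Printing Implicit Defensive.
Import Order.TTheory GRing.Theory Num.Theory.
Import numFieldNormedType.Exports.
Local Open Scope classical_set_scope.
Local Open Scope ring_scope.

(** * Real powers and dyadic iteration *)

Lemma powRN_div (R : realType) (u t : R) : 0 < u -> u `^ (- t) = u `^ (1 - t) / u.
Proof.
move=> u0; rewrite powRB ?(gt_eqF u0) ?implybT// powRr1 ?ltW// powRN; field.
by rewrite !gt_eqF ?powR_gt0.
Qed.

Lemma sqr_powR_half (R : realType) (u t : R) : 0 < u ->
  (u `^ (1 - t / 2)) ^+ 2 = u `^ (1 - t) * u.
Proof.
move=> u0; rewrite -{3}(@powRr1 _ u) ?ltW// -powRD ?(gt_eqF u0) ?implybT//.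
by rewrite -powR_mulrn ?powR_ge0// -powRrM; congr (_ `^ _); field.
Qed.

(** The constant [c] solves c = c 2^(-th) + K, so subtracting c b^th turns the step hypothesis into
    monotonicity along b, b/2, b/4, ... Far enough down this sequence [g] is at most any given e >
    0, and the subtracted term only helps. *)
Lemma dyadic_decay_bound (R : realType) (g : R -> R) (K th : R) :
  0 < th -> 0 <= K ->
  (forall b, 0 < b -> g b <= g (b / 2) + K * b `^ th) ->
  (forall e, 0 < e -> exists2 dl, 0 < dl &
     forall b, 0 < b -> b < dl -> g b <= e) ->
  forall b, 0 < b -> g b <= K / (1 - 2 `^ (- th)) * b `^ th.
Proof.
move=> th0 K0 gstep glim b b0.
set q := 2 `^ (- th); set c := K / (1 - q).
have q1 : q < 1.
  have : 1 `^ th < 2 `^ th :> R by rewrite gt0_ltr_powR// ?nnegrE// ltr1n.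
  by rewrite powR1 /q powRN invf_lt1 ?powR_gt0.
have c0 : 0 <= c by rewrite divr_ge0// subr_ge0 ltW.
have cK : c * (1 - q) = K by rewrite /c mulfVK// subr_eq0 gt_eqF.
have gdec u : 0 < u -> g u - c * u `^ th <= g (u / 2) - c * (u / 2) `^ th.
  move=> u0; have := gstep u u0.
  have -> : (u / 2) `^ th = u `^ th * q.
    rewrite powRM ?ltW ?invr_gt0// /q powRN -[2^-1]powR_inv1// powRAC.
    by rewrite powR_inv1// powR_ge0.
  rewrite -cK; nra.
have gdecn n : g b - c * b `^ th <= g (b / 2 ^+ n) - c * (b / 2 ^+ n) `^ th.
  elim: n => [|n IH]; first by rewrite expr0 divr1.
  apply: (le_trans IH); have := gdec (b / 2 ^+ n).
  rewrite -mulrA -invfM -exprSr; apply.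
  by rewrite divr_gt0// exprn_gt0.
rewrite -subr_le0; apply/ler_addgt0Pl => e e0; rewrite addr0.
have [dl dl0 gdl] := glim e e0.
have [n bn] : exists n, b / 2 ^+ n < dl.
  exists (Num.bound (b / dl)).
  rewrite ltr_pdivrMr ?exprn_gt0// mulrC -ltr_pdivrMr//.
  apply: (lt_trans (archi_boundP _)); first by rewrite divr_ge0// ltW.
  by rewrite -natrX ltr_nat ltn_expl.
have bn0 : 0 < b / 2 ^+ n by rewrite divr_gt0// exprn_gt0.
apply: (le_trans (gdecn n)); have := gdl _ bn0 bn.
have : 0 <= c * (b / 2 ^+ n) `^ th by rewrite mulr_ge0// powR_ge0.
lra.
Qed.

(** * Sums over the wavelet index set, level by level *)

Section DoubleSums.
Variables (R : realType) (N : nat -> nat).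
Implicit Types (f g : Idx N -> R) (x y : Idx N -> R) (B : R).

Definition psum f (m : nat) : R := \sum_(0 <= j < m) \sum_(k < N j) f (idx k).

(** The shape is that of [kt_sum] and of the (1,1) sequence norm, so that both are identified with
    it level by level. *)
Definition tsum f : \bar R :=
  (\sum_(0 <= j <oo) (\sum_(k < N j) f (idx k))%:E)%E.

Lemma psumD f g m : psum (fun l => f l + g l) m = psum f m + psum g m.
Proof. by rewrite /psum -big_split/=; apply: eq_bigr => j _; rewrite -big_split. Qed.

Lemma psumZ c f m : psum (fun l => c * f l) m = c * psum f m.
Proof. by rewrite /psum mulr_sumr; apply: eq_bigr => j _; rewrite mulr_sumr. Qed.

Lemma ler_psum f g m : (forall l, f l <= g l) -> psum f m <= psum g m.
Proof. by move=> fg; apply: ler_sum => j _; apply: ler_sum => k _; exact: fg. Qed.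

Lemma psum_ge0 f m : (forall l, 0 <= f l) -> 0 <= psum f m.
Proof. by move=> f0; apply: sumr_ge0 => j _; apply: sumr_ge0 => k _. Qed.

Lemma psumE f m :
  (psum f m)%:E = (\sum_(0 <= j < m) (\sum_(k < N j) f (idx k))%:E)%E.
Proof. by rewrite /psum sumEFin. Qed.

Lemma level_ge0 f j : (forall l, 0 <= f l) ->
  (0 <= (\sum_(k < N j) f (idx k))%:E)%E.
Proof. by move=> f0; rewrite lee_fin sumr_ge0. Qed.

Lemma tsum_ge0 f : (forall l, 0 <= f l) -> (0 <= tsum f)%E.
Proof. by move=> f0; apply: nneseries_ge0 => j _ _; exact: level_ge0. Qed.

Lemma psum_le_tsum f m : (forall l, 0 <= f l) -> ((psum f m)%:E <= tsum f)%E.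
Proof.
by move=> f0; rewrite psumE; apply: nneseries_lim_ge => j _ _; exact: level_ge0.
Qed.

Lemma tsum_le_ub f z : (forall l, 0 <= f l) ->
  (forall m, ((psum f m)%:E <= z)%E) -> (tsum f <= z)%E.
Proof.
move=> f0 fB; apply: lime_le.
  by apply: is_cvg_nneseries => j _ _; exact: level_ge0.
by apply: nearW => m; rewrite -psumE.
Qed.

Lemma le_tsum f g : (forall l, 0 <= f l) -> (forall l, f l <= g l) ->
  (tsum f <= tsum g)%E.
Proof.
move=> f0 fg; apply: lee_nneseries => [j _ _|j _]; first exact: level_ge0.
by rewrite lee_fin ler_sum.
Qed.

Lemma tsumD f g : (forall l, 0 <= f l) -> (forall l, 0 <= g l) ->
  tsum (fun l => f l + g l) = (tsum f + tsum g)%E.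
Proof.
move=> f0 g0; rewrite /tsum -nneseriesD; [|by move=> *; exact: level_ge0..].
by apply: eq_eseriesr => j _; rewrite big_split EFinD.
Qed.

Lemma tsumZ c f : (forall l, 0 <= f l) ->
  tsum (fun l => c * f l) = (c%:E * tsum f)%E.
Proof.
move=> f0; rewrite /tsum -nneseriesZl; last by move=> *; exact: level_ge0.
by apply: eq_eseriesr => j _; rewrite -mulr_sumr EFinM.
Qed.

Lemma eq_tsum f g : f =1 g -> tsum f = tsum g.
Proof. by move=> fg; congr tsum; apply/funext. Qed.

Lemma psum_approx f B e : (forall l, 0 <= f l) -> tsum f = B%:E -> 0 < e ->
  exists m, B - e <= psum f m.
Proof.
move=> f0 fB e0; apply: contrapT => H.
have : (tsum f <= (B - e)%:E)%E.
  apply: tsum_le_ub => // m; rewrite lee_fin leNgt; apply/negP => Hm.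
  by apply: H; exists m; exact: ltW.
by rewrite fB lee_fin; lra.
Qed.

Lemma psum_term f l : (forall l, 0 <= f l) -> f l <= psum f (tag l).+1.
Proof.
case: l => j k f0 /=; rewrite /psum big_nat_recr//= (bigD1 k)//=.
rewrite addrCA lerDl addr_ge0 ?sumr_ge0// => i _; exact: sumr_ge0.
Qed.

End DoubleSums.

(** * Weighted sequence estimates behind the implications *)

(* For the theorem [r] is [rbar] and [w] is [abar^-2 * rbar], so that [r * w] is
   [abar^-2 * rbar^2] and [r / w] is [abar^2]. *)
Section WeightedSequences.
Variables (R : realType) (N : nat -> nat) (r w : Idx N -> R).
Hypotheses (r0 : forall l, 0 < r l) (w0 : forall l, 0 < w l).
Implicit Types (x y z : Idx N -> R) (t b : R).

Definition wl1 x : \bar R := tsum (fun l => r l * `|x l|).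

(** Left without the square root so that it is additive in the entries, which the pointwise
    comparisons rely on. *)
Definition wl2sq x : \bar R := tsum (fun l => r l / w l * x l ^+ 2).

Definition big_weight x b : \bar R :=
  tsum (fun l => if w l * b < `|x l| then r l * w l else 0).

Lemma wl1_term_ge0 x l : 0 <= r l * `|x l|.
Proof. by rewrite mulr_ge0// ltW. Qed.

Lemma wl2sq_term_ge0 x l : 0 <= r l / w l * x l ^+ 2.
Proof. by rewrite mulr_ge0 ?sqr_ge0// divr_ge0// ltW. Qed.

Lemma rw_ge0 l : 0 <= r l * w l.
Proof. by rewrite mulr_ge0// ltW. Qed.

Lemma big_weight_term_ge0 x b l :
  0 <= (if w l * b < `|x l| then r l * w l else 0).
Proof. by case: ifP => // _; exact: rw_ge0. Qed.

(** Entries with w b/2 < |x| <= w b carry mass at most b W(b/2), so halving b costs at most 2^t Q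
    b^(1-t), and [dyadic_decay_bound] applies with exponent 1 - t > 0. *)
Lemma small_part_bound t (Q : R) x : t < 1 -> 0 <= Q ->
  (forall b, 0 < b -> (big_weight x b <= (Q * b `^ (- t))%:E)%E) ->
  forall b, 0 < b ->
    (tsum (fun l => if (w l * b < `|x l|)%R then 0%R else (r l * `|x l|)%R) <=
      (2 `^ t * Q / (1 - 2 `^ (- (1 - t))) * b `^ (1 - t))%:E)%E.
Proof.
move=> t1 Q0 HW.
(* Decay as b tends to 0 is checked on finitely many levels, where the mass is at most b times the
   finite sum [v]; the resulting bound does not depend on [m]. *)
pose E m b := psum (fun l => if w l * b < `|x l| then 0 else r l * `|x l|) m.
have tm0 b l : 0 <= (if w l * b < `|x l| then 0 else r l * `|x l|).
  by case: ifP => // _; exact: wl1_term_ge0.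
suff H m b : 0 < b ->
    E m b <= 2 `^ t * Q / (1 - 2 `^ (- (1 - t))) * b `^ (1 - t).
  by move=> b b0; apply: tsum_le_ub => // m; rewrite lee_fin; exact: H.
move: b; apply: dyadic_decay_bound.
- by rewrite subr_gt0.
- by rewrite mulr_ge0// powR_ge0.
- move=> b b0; have b20 : 0 < b / 2 by rewrite divr_gt0.
  have -> : 2 `^ t * Q * b `^ (1 - t) = b * (Q * (b / 2) `^ (- t)).
    rewrite powRM ?ltW ?invr_gt0// -[2^-1 in RHS]powR_inv1// -powRrM mulN1r opprK.
    by rewrite powRB ?gt_eqF ?implybT// powRr1 ?ltW// powRN; ring.
  set p := psum (fun l => if w l * (b / 2) < `|x l| then r l * w l else 0) m.
  have pQ : p <= Q * (b / 2) `^ (- t).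
    rewrite -lee_fin; apply: le_trans (HW _ b20); apply: psum_le_tsum.
    exact: big_weight_term_ge0.
  apply: (@le_trans _ _ (E m (b / 2) + b * p)); last first.
    by rewrite lerD2l ler_wpM2l// ltW.
  rewrite /p -psumZ -psumD; apply: ler_psum => l.
  have wb : 0 < w l * b by rewrite mulr_gt0.
  case: ltP => [_|xb].
    rewrite addr_ge0 ?mulr_ge0 ?(ltW b0)//; case: ifP => // _;
      by rewrite (wl1_term_ge0, rw_ge0).
  case: ltP => _; rewrite ?mulr0 ?addr0// add0r.
  by rewrite [leRHS]mulrCA ler_pM2l// mulrC.
- move=> e e0; set v := psum (fun l => r l * w l) m.
  have v0 : 0 <= v by apply: psum_ge0 => l; exact: rw_ge0.
  have v1 : 0 < v + 1 by lra.
  exists (e / (v + 1)); first by rewrite divr_gt0.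
  move=> b b0; rewrite ltr_pdivlMr// => be.
  apply: (@le_trans _ _ (b * v)); last nra.
  rewrite -psumZ; apply: ler_psum => l.
  case: ltP => [_|xb]; first by rewrite mulr_ge0 ?(ltW b0)// rw_ge0.
  by rewrite [leRHS]mulrCA ler_pM2l// mulrC.
Qed.

(** [h] stands for half the squared residual. Once the l1 norm of [x] is added to the error, the
    quadratic term is at most X - Y and cancels the difference of norms; only W(al) and the small
    part remain. *)
Lemma wl1_error_bound t (Q al h Lip : R) x y (X Y : R) :
  0 < t -> t < 1 -> 0 <= Q -> 0 < al -> 0 < Lip ->
  (forall b, 0 < b -> (big_weight x b <= (Q * b `^ (- t))%:E)%E) ->
  wl1 x = X%:E -> wl1 y = Y%:E ->
  (wl2sq (fun l => (x l - y l)%R) <= (2 * Lip ^+ 2 * h)%:E)%E ->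
  h + al * Y <= al * X ->
  (wl1 (fun l => (x l - y l)%R) <=
    ((2 * Lip ^+ 2 + 2 * (2 `^ t / (1 - 2 `^ (- (1 - t))))) * Q
      * al `^ (1 - t))%:E)%E.
Proof.
move=> t0 t1 Q0 al0 L0 HW xX yY H2 hXY.
set K := 2 `^ t / (1 - 2 `^ (- (1 - t))).
have HE := @small_part_bound t Q x t1 Q0 HW al al0.
have HWa := HW al al0.
(* Young's parameter is chosen so that [dl * (2 * Lip ^+ 2 * h)] equals [h / al], which is at most
   [X - Y]. *)
set dl := (2 * al * Lip ^+ 2)^-1.
have L20 : 0 < Lip ^+ 2 by rewrite exprn_gt0.
have dl0 : 0 < dl by rewrite invr_gt0 !mulr_gt0.
set fE := (fun l => if w l * al < `|x l| then 0 else r l * `|x l|) in HE.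
have fE0 l : 0 <= fE l by rewrite /fE; case: ifP => // _; exact: wl1_term_ge0.
set fW := fun l => if w l * al < `|x l| then r l * w l else 0.
have fW0 l : 0 <= fW l by exact: big_weight_term_ge0.
(* Entrywise, with u = x - y, the quantity |u| + |x| - |y| is at most 2|u| above the threshold and
   at most 2|x| below it; the former is split by Young's inequality. *)
have key : (wl1 (fun l => (x l - y l)%R) + wl1 x <= wl1 y +
   (dl%:E * wl2sq (fun l => (x l - y l)%R) +
   (dl^-1%:E * tsum fW + 2%:E * tsum fE)))%E.
  pose u l := x l - y l.
  have -> : (wl1 y + (dl%:E * wl2sq u + (dl^-1%:E * tsum fW + 2%:E * tsum fE)))%E
    = tsum (fun l => r l * `|y l| + (dl * (r l / w l * u l ^+ 2)
        + (dl^-1 * fW l + 2 * fE l))).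
    have dW l : 0 <= dl^-1 * fW l by rewrite mulr_ge0// invr_ge0 ltW.
    have dE l : 0 <= 2 * fE l by rewrite mulr_ge0.
    have du l : 0 <= dl * (r l / w l * u l ^+ 2).
      by rewrite mulr_ge0 ?(ltW dl0)// wl2sq_term_ge0.
    rewrite tsumD => [||l]; [|exact: wl1_term_ge0|by rewrite !addr_ge0].
    rewrite tsumD => [||l]; [|exact: du|by rewrite addr_ge0].
    rewrite tsumD// !tsumZ// => l; exact: wl2sq_term_ge0.
  rewrite /wl1 -tsumD; [|exact: wl1_term_ge0..].
  apply: le_tsum => l; first by rewrite addr_ge0// mulr_ge0// ltW.
  rewrite -/(u l).
  have rl := r0 l; have wl := w0 l.
  have tri : `|x l| <= `|u l| + `|y l| by rewrite -{1}(subrK (y l) (x l)) ler_normD.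
  have tri' : `|u l| <= `|x l| + `|y l| by rewrite ler_normB.
  have un := normr_ge0 (u l); have yn := normr_ge0 (y l).
  have xn := normr_ge0 (x l).
  have sq0 : 0 <= dl * (r l / w l * u l ^+ 2).
    by rewrite mulr_ge0 ?(ltW dl0)// wl2sq_term_ge0.
  rewrite /fW /fE; case: ltP => _; rewrite ?mulr0 ?addr0 ?add0r; last nra.
  (* AM-GM: [2 r |u| <= dl r u^2 / w + r w / dl] *)
  have amgm : 2 * (r l * `|u l|) <=
      dl * (r l / w l * u l ^+ 2) + dl^-1 * (r l * w l).
    rewrite -subr_ge0 -[u l ^+ 2]real_normK ?num_real//.
    have -> : dl * (r l / w l * `|u l| ^+ 2) + dl^-1 * (r l * w l)
        - 2 * (r l * `|u l|)
      = r l / (w l * dl) * (dl * `|u l| - w l) ^+ 2.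
      by field; rewrite !gt_eqF.
    by rewrite mulr_ge0 ?sqr_ge0// divr_ge0 ?ltW// mulr_gt0.
  nra.
have le1 : (wl1 (fun l => (x l - y l)%R) + X%:E <= Y%:E +
   (dl%:E * (2 * Lip ^+ 2 * h)%:E + (dl^-1%:E * (Q * al `^ (- t))%:E
     + 2%:E * (2 `^ t * Q / (1 - 2 `^ (- (1 - t))) * al `^ (1 - t))%:E)))%E.
  rewrite -xX -yY; apply: (le_trans key); apply: leeD2l.
  apply: leeD; first by apply: lee_wpmul2l => //; rewrite lee_fin ltW.
  apply: leeD; first by apply: lee_wpmul2l => //; rewrite lee_fin invr_ge0 ltW.
  exact: lee_wpmul2l.
rewrite -!EFinM -!EFinD -leeBrDr// -EFinB in le1.
apply: (le_trans le1); rewrite lee_fin.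
rewrite (powRN_div _ al0).
have -> : dl * (2 * Lip ^+ 2 * h) = h / al.
  by rewrite /dl; field; rewrite !gt_eqF.
rewrite invrK /K.
have hal : h / al <= X - Y by rewrite ler_pdivrMr//; lra.
set c := (1 - 2 `^ (- (1 - t)))^-1.
have -> : 2 * al * Lip ^+ 2 * (Q * (al `^ (1 - t) / al)) =
    2 * Lip ^+ 2 * Q * al `^ (1 - t).
  by field; rewrite gt_eqF.
lra.
Qed.

(** Finitely many levels carry the mass of [x] up to e/2, and there weighted l2 closeness controls
    every entry. The radius [dl] depends on [x] and [e] only, so one choice serves all
    minimizers. *)
Lemma wl1_lsc x (X e : R) : wl1 x = X%:E -> 0 < e ->
  exists2 dl, 0 < dl & forall y (Y b : R), wl1 y = Y%:E -> 0 <= b -> b < dl ->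
    (wl2sq (fun l => (x l - y l)%R) <= (b ^+ 2)%:E)%E -> X - Y <= e.
Proof.
move=> xX e0; have [m hm] : exists m, X - e / 2 <= psum (fun l => r l * `|x l|) m.
  by apply: psum_approx; rewrite ?divr_gt0//; exact: wl1_term_ge0.
(* An l2 distance [b] gives |x - y| <= sqrt(w/r) b entrywise, so [b * v] bounds the l1 error on the
   first [m] levels; the [+ 1] below keeps the denominator positive. *)
set v := psum (fun l => r l * Num.sqrt (w l / r l)) m.
have v0 : 0 <= v by apply: psum_ge0 => l; rewrite mulr_ge0 ?sqrtr_ge0// ltW.
exists (e / 2 / (v + 1)); first by rewrite !divr_gt0// ltr_wpDl.
move=> y Y b yY b0; rewrite ltr_pdivlMr ?ltr_wpDl// => bdl h2.
have ub l : `|x l - y l| <= Num.sqrt (w l / r l) * b.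
  rewrite -ler_sqr ?nnegrE ?mulr_ge0 ?sqrtr_ge0// real_normK ?num_real//.
  rewrite exprMn sqr_sqrtr ?divr_ge0 ?(ltW (r0 l)) ?(ltW (w0 l))//.
  rewrite -[w l / r l]invf_div mulrC.
  rewrite ler_pdivlMr ?divr_gt0// mulrC -lee_fin; apply: le_trans h2.
  pose f l := r l / w l * (x l - y l) ^+ 2.
  have f0 k : 0 <= f k by exact: (wl2sq_term_ge0 (fun l => x l - y l)).
  apply: le_trans (psum_le_tsum (tag l).+1 f0).
  by rewrite lee_fin; exact: psum_term.
have hY : psum (fun l => r l * `|y l|) m <= Y.
  by rewrite -lee_fin -yY; apply: psum_le_tsum; exact: wl1_term_ge0.
suff : psum (fun l => r l * `|x l|) m <= psum (fun l => r l * `|y l|) m + b * v.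
  move: hY hm bdl; nra.
rewrite /v -psumZ -psumD; apply: ler_psum => l.
rewrite mulrCA -mulrDr ler_pM2l//.
have := ub l; have : `|x l| <= `|x l - y l| + `|y l|.
  by rewrite -{1}(subrK (y l) (x l)) ler_normD.
lra.
Qed.

(** Minimality enters only through [hmin], between two minimizers, and [hz], against sequences
    dominated by [x], which keeps [F] out of the argument. From [hmin] comes the decay of the defect
    X - Y(al); [hz] turns it into a bound on b W(b). *)
Lemma big_weight_bound t (C Lip X : R) x (y : R -> Idx N -> R) (Y e : R -> R) :
  0 < t -> t < 1 -> 0 < C -> 0 < Lip -> wl1 x = X%:E ->
  (forall al : R, 0 < al -> wl1 (y al) = (Y al)%:E) ->
  (forall al : R, 0 < al -> 0 <= e al) ->
  (forall al : R, 0 < al -> e al <= C * al `^ (1 - t / 2)) ->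
  (forall al : R, 0 < al ->
     (wl2sq (fun l => (x l - y al l)%R) <= ((Lip * e al) ^+ 2)%:E)%E) ->
  (forall al be : R, 0 < al -> 0 < be ->
     2^-1 * e al ^+ 2 + al * Y al <= 2^-1 * e be ^+ 2 + al * Y be) ->
  (forall (al : R) z (Z V : R), 0 < al -> (forall l, `|z l| <= `|x l|) ->
     wl1 z = Z%:E -> wl2sq (fun l => (x l - z l)%R) = V%:E ->
     al * Y al <= 2^-1 * Lip ^+ 2 * V + al * Z) ->
  forall b : R, 0 < b -> (big_weight x b <=
    (2 / (1 - 2 `^ (- (1 - t))) * (Lip ^+ 2) `^ (1 - t) * C ^+ 2
       * b `^ (- t))%:E)%E.
Proof.
move=> t0 t1 C0 L0 xX yY e0 eC h2 hmin hz b b0.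
have C20 : 0 <= C ^+ 2 by rewrite sqr_ge0.
have sqe al : 0 < al -> e al ^+ 2 <= C ^+ 2 * al `^ (1 - t) * al.
  move=> al0; rewrite -mulrA -sqr_powR_half// -exprMn ler_sqr ?nnegrE ?e0 ?eC//.
  by rewrite mulr_ge0 ?powR_ge0// ltW.
(* Comparing the minimizers at [al] and [al / 2] bounds the increment of the
   defect [X - Y al] over a dyadic step by the squared residual at [al]. *)
have psi al : 0 < al -> X - Y al <= C ^+ 2 / (1 - 2 `^ (- (1 - t))) * al `^ (1 - t).
  move: al; apply: dyadic_decay_bound => //; first by rewrite subr_gt0.
    move=> al al0; have a20 : 0 < al / 2 by rewrite divr_gt0.
    have := hmin _ _ a20 al0; have := sqe al al0.
    have := sqr_ge0 (e (al / 2)).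
    set P := C ^+ 2 * _; set E2 := e _ ^+ 2; nra.
  move=> ep ep0; have [dl dl0 hdl] := wl1_lsc xX ep0.
  (* [k] solves Lip C k^(1-t/2) = dl, so for [al] below it the distance of [y al] to [x] is within
     the radius of [wl1_lsc]. *)
  pose k := (dl / (Lip * C)) `^ (1 - t / 2)^-1.
  have th0 : 0 < 1 - t / 2 by lra.
  have LC0 : 0 < Lip * C by rewrite mulr_gt0.
  exists k; first by rewrite powR_gt0// divr_gt0.
  move=> al al0 alk; apply: (hdl (y al) (Y al) (Lip * e al)) => //.
  - exact: yY.
  - by rewrite mulr_ge0 ?e0// ltW.
  - apply: (@le_lt_trans _ _ (Lip * (C * al `^ (1 - t / 2)))).
      by rewrite ler_pM2l// eC.
    rewrite mulrA mulrC -ltr_pdivlMr//.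
    have -> : dl / (Lip * C) = k `^ (1 - t / 2).
      by rewrite /k -powRrM mulVf ?gt_eqF// powRr1// divr_ge0// ltW.
    by rewrite gt0_ltr_powR// nnegrE ?powR_ge0// ltW.
  - exact: h2.
(* Only entries above the threshold are shrunk, each by exactly w b. Hence the l1 gain is b W(b) and
   the squared l2 distance is b^2 W(b), both multiples of the quantity to be bounded. *)
pose ind l : R := if w l * b < `|x l| then 1 else 0.
pose z l := x l - ind l * (Num.sg (x l) * (w l * b)).
have wb l : 0 < w l * b by rewrite mulr_gt0.
have zE l : `|x l| = `|z l| + ind l * (w l * b).
  rewrite /z /ind; case: ltP => [h|_]; last by rewrite !mul0r subr0 addr0.
  rewrite !mul1r {2}[x l]numEsg -mulrBr normrM normr_sg.
  have -> : x l != 0 by rewrite -normr_gt0; exact: lt_trans h.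
  by rewrite mul1r ger0_norm ?subr_ge0 ?ltW// subrK.
have ind0 l : 0 <= ind l by rewrite /ind; case: ifP.
have zx l : `|z l| <= `|x l| by rewrite (zE l) lerDl mulr_ge0// ltW.
have W0 : (0 <= big_weight x b)%E by apply: tsum_ge0; exact: big_weight_term_ge0.
have l1E : (wl1 x = wl1 z + b%:E * big_weight x b)%E.
  rewrite -tsumZ; last exact: big_weight_term_ge0.
  rewrite -tsumD; [|exact: wl1_term_ge0|move=> l]; last first.
    by rewrite mulr_ge0 ?(ltW b0)//; exact: big_weight_term_ge0.
  apply: eq_tsum => l; rewrite {1}(zE l) /ind; case: ifP => _; ring.
have l2E : (wl2sq (fun l => (x l - z l)%R) = (b ^+ 2)%:E * big_weight x b)%E.
  rewrite -tsumZ; last exact: big_weight_term_ge0.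
  apply: eq_tsum => l; rewrite /z opprB addrCA subrr addr0 /ind; case: ltP => h.
    have -> : (1 * (Num.sg (x l) * (w l * b))) ^+ 2 = (w l * b) ^+ 2.
      have xn0 : x l != 0 by rewrite -normr_gt0; exact: lt_trans h.
      by rewrite mul1r exprMn sqr_sg xn0 mul1r.
    by field; rewrite gt_eqF.
  by rewrite mul0r expr0n/= !mulr0.
have z0 : (0 <= wl1 z)%E by apply: tsum_ge0; exact: wl1_term_ge0.
move: l1E l2E W0 z0; rewrite xX.
case: (big_weight x b) => [W| |]; last by [].
  case zZ : (wl1 z) => [Z| |] // [XE] l2E; rewrite !lee_fin => W0 Z0.
  (* With this [al] the residual cost Lip^2 b^2 W / 2 is half the penalty gain al b W, so half of
     the gain survives. *)
  set al := b * Lip ^+ 2.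
  have L20 : 0 < Lip ^+ 2 by rewrite exprn_gt0.
  have al0 : 0 < al by rewrite mulr_gt0.
  have := hz al z Z (b ^+ 2 * W) al0 zx zZ l2E.
  have -> : 2^-1 * Lip ^+ 2 * (b ^+ 2 * W) = al * (2^-1 * b * W).
    by rewrite /al; ring.
  rewrite -mulrDr ler_pM2l// => hY.
  have hW : b * W <= 2 * (X - Y al) by lra.
  have hW2 := psi al al0.
  rewrite (powRN_div _ b0) mulrA ler_pdivlMr// mulrC; apply: (le_trans hW).
  move: hW2; rewrite /al powRM ?(ltW b0) ?(ltW L20)//; set c := (1 - _)^-1 => hW2.
  lra.
(* An infinite W(b) would make the l1 norm of [x] infinite. *)
by rewrite gt0_muley ?lte_fin//; case: (wl1 z).
Qed.

End WeightedSequences.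

(** * Finiteness of the weighted norms *)

Section Finiteness.
Variables (R : realType) (N : nat -> nat) (r w : Idx N -> R).
Hypotheses (r0 : forall l, 0 < r l) (w0 : forall l, 0 < w l).
Implicit Types (x y : Idx N -> R).

Lemma wl1_ge0 x : (0 <= wl1 r x)%E.
Proof. by apply: tsum_ge0; exact: wl1_term_ge0. Qed.

Lemma wl2sq_ge0 x : (0 <= wl2sq r w x)%E.
Proof. by apply: tsum_ge0; exact: wl2sq_term_ge0. Qed.

Lemma wl1_sub_lty x y : (wl1 r x < +oo)%E -> (wl1 r y < +oo)%E ->
  (wl1 r (fun l => (x l - y l)%R) < +oo)%E.
Proof.
move=> hx hy; apply: (@le_lt_trans _ _ (wl1 r x + wl1 r y)%E).
  rewrite -tsumD; [|exact: wl1_term_ge0..].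
  apply: le_tsum => l; first by rewrite mulr_ge0// ltW.
  by rewrite -mulrDr ler_pM2l// ler_normB.
by rewrite lte_add_pinfty.
Qed.

Lemma wl2sq_sub_lty x y : (wl2sq r w x < +oo)%E -> (wl2sq r w y < +oo)%E ->
  (wl2sq r w (fun l => (x l - y l)%R) < +oo)%E.
Proof.
move=> hx hy.
apply: (@le_lt_trans _ _ (2%:E * (wl2sq r w x + wl2sq r w y))%E).
  rewrite -tsumD; [|exact: wl2sq_term_ge0..].
  rewrite -tsumZ; last by move=> l; rewrite addr_ge0// wl2sq_term_ge0.
  apply: le_tsum => l; first by rewrite mulr_ge0 ?sqr_ge0// divr_ge0// ltW.
  rewrite -mulrDr [leRHS]mulrCA ler_pM2l ?divr_gt0//.
  have := sqr_ge0 (x l + y l); nra.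
by rewrite lte_mul_pinfty// lte_add_pinfty.
Qed.

Lemma wl2sq_le x y : (forall l, `|x l| <= `|y l|) -> (wl2sq r w x <= wl2sq r w y)%E.
Proof.
move=> xy; apply: le_tsum => l; first exact: wl2sq_term_ge0.
rewrite ler_pM2l ?divr_gt0// -(real_normK (num_real (x l))).
by rewrite -(real_normK (num_real (y l))) ler_sqr ?nnegrE.
Qed.

(** Every term r|x| is at most the total X, and r w >= 1 gives (r/w) x^2 <= (r|x|)^2 <= X r|x|. For
    the Besov weights this embeds b^0_{1,1} into b^{-a}_{2,2}. *)
Lemma wl1_wl2sq_lty x : (forall l, 1 <= r l * w l) ->
  (wl1 r x < +oo)%E -> (wl2sq r w x < +oo)%E.
Proof.
move=> rw1; have := wl1_ge0 x; case E: (wl1 r x) => [X| |]// X0 _.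
apply: (@le_lt_trans _ _ (X%:E * wl1 r x)%E); last by rewrite E -EFinM ltry.
rewrite -tsumZ; last exact: wl1_term_ge0.
apply: le_tsum => l; first exact: wl2sq_term_ge0.
have hX : r l * `|x l| <= X.
  rewrite -lee_fin -E; pose f l := r l * `|x l|.
  have f0 k : 0 <= f k by exact: wl1_term_ge0.
  by apply: le_trans (psum_le_tsum (tag l).+1 f0); rewrite lee_fin (psum_term l f0).
apply: (@le_trans _ _ ((r l * `|x l|) * (r l * `|x l|))); last first.
  by rewrite ler_wpM2r// wl1_term_ge0.
rewrite -expr2 exprMn real_normK ?num_real// ler_wpM2r ?sqr_ge0//.
by rewrite expr2 ler_pM2l// -div1r ler_pdivrMr.
Qed.

End Finiteness.

(** * Identification with the Besov sequence norms and the k_t norm *)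

Section BesovWeights.
Variables (R : realType) (d : nat) (N : nat -> nat) (a : R).
Implicit Types (x : Idx N -> R).

Definition rwt (l : Idx N) : R := 2 `^ (- ((tag l)%:R * (d%:R / 2))).

Definition wwt (l : Idx N) : R := 2 `^ ((tag l)%:R * (2 * a - d%:R / 2)).

Lemma rwt_gt0 l : 0 < rwt l.
Proof. by rewrite powR_gt0. Qed.

Lemma wwt_gt0 l : 0 < wwt l.
Proof. by rewrite powR_gt0. Qed.

Lemma rwt_wwt l : rwt l * wwt l = 2 `^ ((tag l)%:R * (2 * a - d%:R)).
Proof.
rewrite -powRD; last by rewrite pnatr_eq0 implybT.
by congr (_ `^ _); field.
Qed.

(** Since 2a - d > 0, the embedding [wl1_wl2sq_lty] applies to these weights. *)
Lemma rwt_wwt_ge1 l : d%:R / 2 < a -> 1 <= rwt l * wwt l.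
Proof.
move=> da; rewrite rwt_wwt -{1}(powRr0 2) ler_powR ?ler1n// mulr_ge0//; lra.
Qed.

Lemma bnorm11E x : bnorm d 0 1%:E 1%:E x = wl1 rwt x.
Proof.
rewrite /bnorm /= invr1 poweRe1; last first.
  by apply: nneseries_ge0 => j _ _; rewrite lee_fin powR_ge0.
apply: eq_eseriesr => j _; congr _%:E.
under eq_bigr do rewrite powRr1//.
rewrite !powRr1 ?mulr_ge0 ?powR_ge0 ?sumr_ge0// mulr_sumr.
apply: eq_bigr => k _; congr (_ `^ _ * _).
by field.
Qed.

(** For p = 2 the exponents d/2 and d/p cancel, and the squared level weight 2^(-2ja) is
    [rwt / wwt]. *)
Lemma bnorm22E x : bnorm d (- a) 2%:E 2%:E x = poweR (wl2sq rwt wwt x) 2^-1.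
Proof.
rewrite /bnorm /=; congr poweR; apply: eq_eseriesr => j _; congr _%:E.
rewrite powRM ?powR_ge0// -!powRrM mulVf// powRr1; last first.
  by rewrite sumr_ge0// => k _; rewrite powR_ge0.
rewrite mulr_sumr; apply: eq_bigr => k _.
rewrite powR_mulrn// real_normK ?num_real//.
congr (_ * _); rewrite /rwt /wwt /= -powRB ?pnatr_eq0 ?implybT//.
by congr (_ `^ _); field.
Qed.

Lemma kt_sumE x al : kt_sum d a x al = big_weight rwt wwt x al.
Proof.
apply: eq_eseriesr => j _; congr _%:E; apply: eq_bigr => k _.
by rewrite rwt_wwt.
Qed.

(** Together with [kt_norm_le_big_weight] this treats the k_t norm as a weak-type norm, with Q =
    rho^t as the dictionary. *)
Lemma big_weight_le_kt_norm t (rho : R) x al : 0 < t -> 0 <= rho ->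
  (kt_norm d a t x <= rho%:E)%E -> 0 < al ->
  (big_weight rwt wwt x al <= (rho `^ t * al `^ (- t))%:E)%E.
Proof.
move=> t0 rho0 hrho al0.
have W0 : (0 <= big_weight rwt wwt x al)%E.
  by apply: tsum_ge0; apply: big_weight_term_ge0; [exact: rwt_gt0|exact: wwt_gt0].
have : (al%:E * poweR (big_weight rwt wwt x al) t^-1 <= rho%:E)%E.
  by apply: le_trans hrho; rewrite -kt_sumE; apply: ereal_sup_ubound; exists al.
move: W0; case: (big_weight _ _ _ _) => [W| |]//.
  rewrite poweR_EFin -EFinM !lee_fin => W0 h.
  have -> : W = (W `^ t^-1) `^ t by rewrite -powRrM mulVf ?gt_eqF// powRr1.
  have -> : al `^ (- t) = (al^-1) `^ t by rewrite -powR_inv1 ?ltW// -powRrM mulN1r.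
  rewrite -powRM ?invr_ge0 ?(ltW al0)//.
  rewrite ge0_ler_powR ?nnegrE ?powR_ge0 ?mulr_ge0 ?invr_ge0 ?(ltW al0) ?(ltW t0)//.
  by rewrite ler_pdivlMr// mulrC.
by rewrite poweRyr ?gt_eqF ?invr_gt0// gt0_muley ?lte_fin.
Qed.

Lemma kt_norm_le_big_weight t (Q : R) x : 0 < t -> 0 <= Q ->
  (forall al, 0 < al -> (big_weight rwt wwt x al <= (Q * al `^ (- t))%:E)%E) ->
  (kt_norm d a t x <= (Q `^ t^-1)%:E)%E.
Proof.
move=> t0 Q0 HW; apply: ge_ereal_sup => _ [al al0 <-].
have al0' : 0 < al by [].
have W0 : (0 <= big_weight rwt wwt x al)%E.
  by apply: tsum_ge0; apply: big_weight_term_ge0; [exact: rwt_gt0|exact: wwt_gt0].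
move: W0 (HW al al0); rewrite kt_sumE; case: (big_weight _ _ _ _) => [W| |]//.
rewrite poweR_EFin -EFinM !lee_fin => W0 h.
have : W `^ t^-1 <= (Q * al `^ (- t)) `^ t^-1.
  by rewrite ge0_ler_powR ?nnegrE ?mulr_ge0 ?powR_ge0 ?invr_ge0 ?(ltW t0).
rewrite powRM ?powR_ge0// -powRrM mulNr mulfV ?gt_eqF// powR_inv1 ?(ltW al0')//.
by rewrite ler_pdivlMr// mulrC.
Qed.

Lemma kt_norm_ge0 t x : (0 <= kt_norm d a t x)%E.
Proof.
apply: (@le_trans _ _ (1%:E * poweR (kt_sum d a x 1) t^-1)%E).
  by rewrite mule_ge0 ?poweR_ge0.
by apply: ereal_sup_ubound; exists 1 => //=.
Qed.

End BesovWeights.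

(** * The equivalence theorem *)

(** [Bn] has no sign a priori; nonnegativity comes from the constant [C] of (W). Then [M], of
    unknown sign, can be enlarged to a positive constant that still depends on [M] alone. *)
Lemma max1_norm_equiv (R : realType) (C M : R) (b B : \bar R) :
  0 < C -> (0 <= b)%E -> (b <= C%:E * B)%E ->
  (B <= M%:E * b)%E /\ (b <= M%:E * B)%E ->
  [/\ (0 <= B)%E, (B <= (Num.max 1 M)%:E * b)%E & (b <= (Num.max 1 M)%:E * B)%E].
Proof.
move=> C0 b0 bCB [h1 h2].
have B0 : (0 <= B)%E.
  rewrite leNgt; apply/negP => Bn0.
  have : (C%:E * B < 0)%E by rewrite mule_gt0_lt0 ?lte_fin.
  by rewrite ltNge (le_trans b0 bCB).
have MM : (M%:E <= (Num.max 1 M)%:E)%E by rewrite lee_fin le_max lexx orbT.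
split => //; [apply: (le_trans h1)|apply: (le_trans h2)]; exact: lee_wpmul2r.
Qed.

Theorem theorem6p6 (R : realType) (L t M : R) :
  exists c : R, 0 < c /\
  forall (d : nat) (N : nat -> nat) (CL smax a s : R) (X : lmodType R)
    (Bn : R -> \bar R -> \bar R -> X -> \bar R) (S : (Idx N -> R) -> X)
    (Y : completeNormedModType R) (DF : set X) (F : X -> Y) (fp : X)
    (xa : R -> Idx N -> R),
  (0 < d)%N -> 0 < CL ->
  (forall j, 2 ^ (j * d) <= N j)%N ->
  (forall j, (N j)%:R <= CL * 2 ^+ (j * d)) ->
  0 < smax -> 0 < a -> d%:R / 2 < a -> a < smax ->
  assumption_W d smax Bn S -> opnorm_bound d a M Bn S ->
  assumption_B a L Bn DF F ->
  (forall x z, Dset d a S DF x -> (bnorm d (- a) 2%:E 2%:E z < +oo)%E ->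
     (forall l, `|z l| <= `|x l|) -> Dset d a S DF z) ->
  DF fp -> (Bn 0%R 1%:E 1%:E fp < +oo)%E ->
  0 < s -> t = 2 * a / (s + 2 * a) ->
  (forall al : R, 0 < al -> Dset d a S DF (xa al) /\
     forall x, Dset d a S DF x -> (Tik d S F fp al (xa al) <= Tik d S F fp al x)%E) ->
  let K_i := exists xp, [/\ (bnorm d 0%R 1%:E 1%:E xp < +oo)%E, S xp = fp
                          & (kt_norm d a t xp < +oo)%E] in
  let P_ii := exists C2 : R, 0 < C2 /\ forall al : R, 0 < al ->
       (Bn 0%R 1%:E 1%:E (fp - S (xa al))%R <= (C2 * al `^ (s / (s + 2 * a)))%:E)%E in
  let P_iii := exists C3 : R, 0 < C3 /\ forall al : R, 0 < al ->
       `|F fp - F (S (xa al))| <= C3 * al `^ ((s + a) / (s + 2 * a)) in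
  [/\ (K_i <-> P_ii), (P_ii <-> P_iii),
      (forall xp, (bnorm d 0%R 1%:E 1%:E xp < +oo)%E -> S xp = fp ->
         (kt_norm d a t xp < +oo)%E ->
         forall al : R, 0 < al ->
           (Bn 0%R 1%:E 1%:E (fp - S (xa al))%R <=
              (c * fine (kt_norm d a t xp) `^ t * al `^ (s / (s + 2 * a)))%:E)%E),
      (forall C2 : R, 0 < C2 ->
         (forall al : R, 0 < al ->
            (Bn 0%R 1%:E 1%:E (fp - S (xa al))%R <= (C2 * al `^ (s / (s + 2 * a)))%:E)%E) ->
         forall al : R, 0 < al ->
           `|F fp - F (S (xa al))| <= c * C2 `^ (2^-1) * al `^ ((s + a) / (s + 2 * a)))
    & (forall C3 : R, 0 < C3 ->
         (forall al : R, 0 < al ->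
            `|F fp - F (S (xa al))| <= C3 * al `^ ((s + a) / (s + 2 * a))) ->
         forall xp, (bnorm d 0%R 1%:E 1%:E xp < +oo)%E -> S xp = fp ->
           (kt_norm d a t xp <= (c * C3 `^ (2 / t))%:E)%E)].
Proof.
(* [Lip] is the bi-Lipschitz constant of F o S for the weighted l2 norm, [q] sums the dyadic series,
   and [c1], [c2], [c3] belong to (i) => (ii), (ii) => (iii) and (iii) => (i). *)
pose M1 := Num.max 1 M; pose Lip := M1 * L.
pose q := (1 - 2 `^ (- (1 - t)))^-1.
pose c1 := M1 * (2 * Lip ^+ 2 + 2 * (2 `^ t * q)).
pose c2 := (2 * M1) `^ 2^-1.
pose c3 := (2 * q * (Lip ^+ 2) `^ (1 - t)) `^ t^-1.
(* Nothing is known yet about the sign of [L] or the range of [t], so [c1] might be negative; hence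
   the absolute value. *)
exists (1 + `|c1| + c2 + c3).
have c2_0 : 0 <= c2 by exact: powR_ge0.
have c3_0 : 0 <= c3 by exact: powR_ge0.
have c_gt0 : 0 < 1 + `|c1| + c2 + c3.
  by rewrite -!addrA ltr_pwDl// !addr_ge0.
split=> //.
move=> d N CL smax a s X Bn S Y DF F fp xa.
move=> d0 CL0 Nlo Nhi smax0 a0 da asm [Slin W] OP [L0 _ DFfin _ Flip] Dmono.
move=> DFfp fpfin s0 tE xamin.
set r : Idx N -> R := @rwt R d N; set w : Idx N -> R := @wwt R d N a.
have r0 l : 0 < r l by exact: rwt_gt0.
have w0 l : 0 < w l by exact: wwt_gt0.
have t0 : 0 < t by rewrite tE divr_gt0//; lra.
have sa0 : s + 2 * a != 0 by rewrite gt_eqF//; lra.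
have E1 : s / (s + 2 * a) = 1 - t by rewrite tE; field.
have E2 : (s + a) / (s + 2 * a) = 1 - t / 2 by rewrite tE; field.
have t1 : t < 1 by rewrite -subr_gt0 -E1 divr_gt0//; lra.
rewrite {}E1 {}E2.
have M1_1 : 1 <= M1 by rewrite /M1 le_max lexx.
have M1_0 : 0 < M1 by exact: lt_le_trans M1_1.
have Lip0 : 0 < Lip by rewrite mulr_gt0.
have q0 : 0 < q.
  have : 1 `^ (1 - t) < 2 `^ (1 - t) :> R.
    by rewrite gt0_ltr_powR ?nnegrE// ?ltr1n// subr_gt0.
  by rewrite powR1 => h; rewrite invr_gt0 subr_gt0 powRN invf_lt1 ?powR_gt0.
have n1E x : bnorm d 0 1%:E 1%:E x = wl1 r x by exact: bnorm11E.
have n2E x : bnorm d (- a)%R 2%:E 2%:E x = poweR (wl2sq r w x) 2^-1.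
  exact: bnorm22E.
have SB x y : S (fun l => x l - y l) = S x - S y.
  rewrite addrC -scaleN1r -Slin; congr S; apply/funext => l.
  by rewrite mulN1r addrC.
have op1 x : (wl1 r x < +oo)%E -> [/\ (0 <= Bn 0%R 1%:E 1%:E (S x))%E,
    (Bn 0%R 1%:E 1%:E (S x) <= M1%:E * wl1 r x)%E
  & (wl1 r x <= M1%:E * Bn 0%R 1%:E 1%:E (S x))%E].
  rewrite -n1E => xfin.
  have [|||_ _ [C [C0 hC]]] := W 0 1%:E 1%:E; rewrite ?lte_fin//.
    by rewrite oppr_lt0 smax0.
  apply: (max1_norm_equiv C0); first by rewrite n1E wl1_ge0.
    exact: (hC x xfin).2.
  by apply: OP => //; left.
have op2 x : (bnorm d (- a)%R 2%:E 2%:E x < +oo)%E ->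
  [/\ (0 <= Bn (- a)%R 2%:E 2%:E (S x))%E,
    (Bn (- a)%R 2%:E 2%:E (S x) <= M1%:E * bnorm d (- a)%R 2%:E 2%:E x)%E
  & (bnorm d (- a)%R 2%:E 2%:E x <= M1%:E * Bn (- a)%R 2%:E 2%:E (S x))%E].
  move=> xfin.
  have [|||_ _ [C [C0 hC]]] := W (- a) 2%:E 2%:E; rewrite ?lte_fin//.
    by apply/andP; split; lra.
  apply: (max1_norm_equiv C0); first by rewrite n2E poweR_ge0.
    exact: (hC x xfin).2.
  by apply: OP => //; right.
have n2fin x : (bnorm d (- a)%R 2%:E 2%:E x < +oo)%E <-> (wl2sq r w x < +oo)%E.
  rewrite n2E; split=> [|h]; last exact: poweR_lty.
  by case: (wl2sq r w x) => [u| |]//; rewrite ?ltry// poweRyr ?invr_eq0.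
have lip x y : Dset d a S DF x -> Dset d a S DF y -> exists V : R,
  [/\ wl2sq r w (fun l => (x l - y l)%R) = V%:E,
      V <= (Lip * `|F (S x) - F (S y)|) ^+ 2
    & `|F (S x) - F (S y)| ^+ 2 <= Lip ^+ 2 * V].
  move=> [/n2fin xf Dx] [/n2fin yf Dy].
  have := wl2sq_sub_lty r0 w0 xf yf; have := wl2sq_ge0 r0 w0 (fun l => x l - y l).
  case E : (wl2sq r w _) => [V| |]//; rewrite lee_fin => V0 Vf; exists V.
  have := op2 (fun l => x l - y l); rewrite n2fin E => /(_ Vf) [].
  rewrite n2E E poweR_EFin SB; have [] := Flip _ _ Dx Dy.
  case: (Bn _ _ _ _) => [v| |] hv1 hv2 v0 hv3 hv4.
  (* The value [-oo] contradicts nonnegativity, and [+oo] contradicts the lower Lipschitz bound of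
     [F]. *)
  3: by move: v0; rewrite leeNy_eq.
  2: by move: hv1; rewrite gt0_muley// lte_fin invr_gt0.
  rewrite -!EFinM !lee_fin in hv1 hv2 v0 hv3 hv4.
  have sV : V = (V `^ 2^-1) ^+ 2.
    by rewrite -powR_mulrn ?powR_ge0// -powRrM mulVf// powRr1.
  split=> //.
    rewrite sV ler_sqr ?nnegrE ?powR_ge0//; last by rewrite mulr_ge0// ltW.
    apply: (le_trans hv4); rewrite /Lip -mulrA ler_pM2l//.
    by rewrite -ler_pdivrMl.
  rewrite sV -exprMn ler_sqr ?nnegrE//; last by rewrite mulr_ge0 ?powR_ge0// ltW.
  by apply: (le_trans hv2); rewrite /Lip -mulrA mulrCA ler_pM2l.
have core xp : (bnorm d 0%R 1%:E 1%:E xp < +oo)%E -> S xp = fp ->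
  [/\ (kt_norm d a t xp < +oo)%E -> forall al, 0 < al ->
        (Bn 0%R 1%:E 1%:E (fp - S (xa al))%R <=
          (c1 * fine (kt_norm d a t xp) `^ t * al `^ (1 - t))%:E)%E,
      forall C2 : R, 0 < C2 -> (forall al, 0 < al ->
        (Bn 0%R 1%:E 1%:E (fp - S (xa al))%R <= (C2 * al `^ (1 - t))%:E)%E) ->
        forall al, 0 < al ->
          `|F fp - F (S (xa al))| <= c2 * C2 `^ 2^-1 * al `^ (1 - t / 2)
    & forall C3 : R, 0 < C3 -> (forall al, 0 < al ->
        `|F fp - F (S (xa al))| <= C3 * al `^ (1 - t / 2)) ->
        (kt_norm d a t xp <= (c3 * C3 `^ (2 / t))%:E)%E].
  rewrite n1E => xpfin Sxp.
  have xpD : Dset d a S DF xp.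
    split; last by rewrite Sxp.
    by apply/n2fin/(wl1_wl2sq_lty r0 w0) => // l; exact: rwt_wwt_ge1.
  have [n1xp XE] : exists n1xp, wl1 r xp = n1xp%:E.
    by move: xpfin (wl1_ge0 r0 xp); case: (wl1 r xp) => [n1xp| |]// _ _; exists n1xp.
  pose e al := `|F fp - F (S (xa al))|.
  have e0 al : 0 <= e al by exact: normr_ge0.
  (* Comparison with [xp], where the functional is finite, shows that the minimizers have finite l1
     norm, so [fine] loses nothing. *)
  pose Z al := fine (wl1 r (xa al)).
  have ZE al : 0 < al -> wl1 r (xa al) = (Z al)%:E.
    move=> al0; rewrite /Z; have := (xamin al al0).2 xp xpD.
    rewrite /Tik !n1E XE; have := wl1_ge0 r0 (xa al).
    by case: (wl1 r (xa al)) => [u| |]//; rewrite gt0_muley ?lte_fin.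
  have minim al x z : 0 < al -> Dset d a S DF x -> wl1 r x = z%:E ->
      2^-1 * e al ^+ 2 + al * Z al <= 2^-1 * `|F fp - F (S x)| ^+ 2 + al * z.
    move=> al0 Dx xz; have := (xamin al al0).2 x Dx.
    by rewrite /Tik !n1E ZE// xz -!EFinM -!EFinD lee_fin.
  have minxp al : 0 < al -> 2^-1 * e al ^+ 2 + al * Z al <= al * n1xp.
    move=> al0; apply: le_trans (minim al xp n1xp al0 xpD XE) _.
    by rewrite Sxp subrr normr0 expr0n mulr0 add0r.
  have difffin al : 0 < al -> (wl1 r (fun l => (xp l - xa al l)%R) < +oo)%E.
    by move=> al0; apply: wl1_sub_lty => //; rewrite ?XE ?ZE ?ltry.
  have lipxa al : 0 < al ->
      (wl2sq r w (fun l => (xp l - xa al l)%R) <= ((Lip * e al) ^+ 2)%:E)%E.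
    move=> al0; have [V [-> hV _]] := lip xp (xa al) xpD (xamin al al0).1.
    by rewrite lee_fin; move: hV; rewrite Sxp.
  split.
  - move=> ktf al al0; have kt0 := kt_norm_ge0 d a t xp.
    have ktE : kt_norm d a t xp = (fine (kt_norm d a t xp))%:E.
      by rewrite fineK// ge0_fin_numE.
    move: ktE kt0; set rho := fine _ => ktE; rewrite ktE lee_fin => rho0.
    have HW b : 0 < b -> (big_weight r w xp b <= (rho `^ t * b `^ (- t))%:E)%E.
      by move=> b0; apply: big_weight_le_kt_norm => //; rewrite ktE.
    have h2 : (wl2sq r w (fun l => (xp l - xa al l)%R) <=
        (2 * Lip ^+ 2 * (2^-1 * e al ^+ 2))%:E)%E.
      apply: (le_trans (lipxa al al0)); rewrite lee_fin le_eqVlt.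
      by apply/orP; left; apply/eqP; field.
    have := wl1_error_bound r0 w0 t0 t1 (powR_ge0 _ _) al0 Lip0 HW XE (ZE al al0)
      h2 (minxp al al0).
    rewrite -/q => hb; have [_ hB _] := op1 _ (difffin al al0).
    rewrite SB Sxp in hB; apply: (le_trans hB).
    rewrite /c1 -!mulrA EFinM lee_wpmul2l ?lee_fin ?(ltW M1_0)//.
    by rewrite !mulrA; move: hb; rewrite !mulrA.
  - move=> C2 C20 hB al al0.
    have [_ _ h1] := op1 _ (difffin al al0).
    (* The triangle inequality bounds the defect by the error; minimality then gives e^2 <= 2 al
       (n1xp - Z al), whence c2^2 = 2 M1. *)
    have h3 : n1xp - Z al <= M1 * (C2 * al `^ (1 - t)).
      rewrite -lee_fin EFinB -XE -ZE// leeBlDr ?ZE//.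
      apply: (@le_trans _ _ (wl1 r (fun l => (xp l - xa al l)%R) + wl1 r (xa al))%E).
        rewrite -tsumD; [|exact: wl1_term_ge0..].
        apply: le_tsum => l; first exact: wl1_term_ge0.
        rewrite -mulrDr ler_pM2l//.
        by rewrite -{1}(subrK (xa al l) (xp l)) ler_normD.
      rewrite ZE//; apply: leeD2r; apply: (le_trans h1); rewrite EFinM.
      apply: lee_wpmul2l; first by rewrite lee_fin ltW.
      by rewrite SB Sxp; exact: hB.
    have h4 : e al ^+ 2 <= (c2 * C2 `^ 2^-1 * al `^ (1 - t / 2)) ^+ 2.
      have -> : (c2 * C2 `^ 2^-1 * al `^ (1 - t / 2)) ^+ 2
          = 2 * M1 * C2 * (al `^ (1 - t) * al).
        rewrite -sqr_powR_half// !exprMn -[c2 ^+ 2]powR_mulrn//.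
        rewrite -[(C2 `^ _) ^+ 2]powR_mulrn ?powR_ge0//.
        by rewrite /c2 -!powRrM mulVf// !powRr1 ?ltW// mulr_gt0.
      have := minxp al al0; set P := al `^ _ in h3 *; move: h3; nra.
    by move: h4; rewrite ler_sqr ?nnegrE ?mulr_ge0 ?powR_ge0 ?e0.
  - move=> C3 C30 hF.
    (* Reading C3^(2/t) as (C3^2)^(1/t) gives the form Q^(1/t) of [kt_norm_le_big_weight]. *)
    have -> : c3 * C3 `^ (2 / t) =
        (2 * q * (Lip ^+ 2) `^ (1 - t) * C3 ^+ 2) `^ t^-1.
      rewrite [RHS]powRM ?sqr_ge0 ?mulr_ge0 ?powR_ge0 ?(ltW q0)//.
      by rewrite powRrM powR_mulrn// ltW.
    apply: kt_norm_le_big_weight => //.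
      by rewrite !mulr_ge0 ?sqr_ge0 ?powR_ge0// ltW.
    apply: (big_weight_bound r0 w0 (y := xa) (Y := Z) (e := e)) XE _ _ _ _ _ _ => //.
      move=> al be al0 be0; apply: minim => //; first exact: (xamin be be0).1.
      exact: ZE.
    (* The solidity of D makes [z] admissible; the Lipschitz bound replaces its residual, and the
       squared residual of the minimizer is dropped. *)
    move=> al z z1 V al0 zx zE zV.
    have zD : Dset d a S DF z.
      apply: (Dmono xp) => //; apply/n2fin.
      apply: le_lt_trans (wl2sq_le r0 w0 zx) _; apply/n2fin; exact: xpD.1.
    have [V' [V'E _ hV']] := lip xp z xpD zD.
    have := minim al z z1 al0 zD zE.
    move: V'E; rewrite zV => -[VV]; subst V'.
    move: hV'; rewrite Sxp; have := sqr_ge0 (e al); lra.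
set c := 1 + `|c1| + c2 + c3 in c_gt0 *.
have c1_le : c1 <= c by rewrite /c; have := ler_norm c1; lra.
have c2_le : c2 <= c by rewrite /c; have := normr_ge0 c1; lra.
have c3_le : c3 <= c by rewrite /c; have := normr_ge0 c1; lra.
(* Surjectivity of S from b^0_{1,1} supplies the coefficients of f^+, which (ii) and (iii) do not
   mention. *)
have [xp0 [xp0fin Sxp0]] : exists x, (bnorm d 0%R 1%:E 1%:E x < +oo)%E /\ S x = fp.
  have [|||_ surj _] := W 0 1%:E 1%:E; rewrite ?lte_fin ?oppr_lt0 ?smax0//.
  exact: surj.
have kt_to_err xp : (bnorm d 0%R 1%:E 1%:E xp < +oo)%E -> S xp = fp ->
    (kt_norm d a t xp < +oo)%E -> forall al : R, 0 < al ->
    (Bn 0%R 1%:E 1%:E (fp - S (xa al))%R <=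
      (c * fine (kt_norm d a t xp) `^ t * al `^ (1 - t))%:E)%E.
  move=> xpfin Sxp ktf al al0; have [h _ _] := core xp xpfin Sxp.
  by apply: (le_trans (h ktf al al0)); rewrite lee_fin !ler_wpM2r ?powR_ge0.
have err_to_res (C2 : R) : 0 < C2 -> (forall al : R, 0 < al ->
      (Bn 0%R 1%:E 1%:E (fp - S (xa al))%R <= (C2 * al `^ (1 - t))%:E)%E) ->
    forall al : R, 0 < al ->
      `|F fp - F (S (xa al))| <= c * C2 `^ 2^-1 * al `^ (1 - t / 2).
  move=> C20 hB al al0; have [_ h _] := core xp0 xp0fin Sxp0.
  by apply: (le_trans (h C2 C20 hB al al0)); rewrite !ler_wpM2r ?powR_ge0.
have res_to_kt (C3 : R) : 0 < C3 -> (forall al : R, 0 < al ->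
      `|F fp - F (S (xa al))| <= C3 * al `^ (1 - t / 2)) ->
    forall xp, (bnorm d 0%R 1%:E 1%:E xp < +oo)%E -> S xp = fp ->
    (kt_norm d a t xp <= (c * C3 `^ (2 / t))%:E)%E.
  move=> C30 hF xp xpfin Sxp; have [_ _ h] := core xp xpfin Sxp.
  by apply: (le_trans (h C3 C30 hF)); rewrite lee_fin ler_wpM2r ?powR_ge0.
move=> K_i P_ii P_iii.
have i_ii : K_i -> P_ii.
  move=> [xp [xpfin Sxp ktf]].
  have C0 : 0 <= c * fine (kt_norm d a t xp) `^ t.
    by rewrite mulr_ge0 ?powR_ge0// ltW.
  (* The [+ 1] keeps C2 positive even when the k_t norm vanishes. *)
  exists (c * fine (kt_norm d a t xp) `^ t + 1); split; first by rewrite ltr_wpDl.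
  move=> al al0; apply: (le_trans (kt_to_err xp xpfin Sxp ktf al al0)).
  by rewrite lee_fin ler_wpM2r ?powR_ge0// lerDl.
have ii_iii : P_ii -> P_iii.
  move=> [C2 [C20 hB]]; exists (c * C2 `^ 2^-1).
  by split; [rewrite mulr_gt0// powR_gt0|exact: err_to_res].
have iii_i : P_iii -> K_i.
  move=> [C3 [C30 hF]]; exists xp0; split=> //.
  by apply: le_lt_trans (res_to_kt C3 C30 hF xp0 xp0fin Sxp0) _; rewrite ltry.
split=> //; split; auto.
Qed.
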